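(* Let $G=(V,E)$ be a finite connected simple graph with vertex set $V=\{a_1,\dots,a_N\}$, $N\ge 2$, let $\Psi=(\Psi_i)_{i=1}^N\in\mathbb{R}^N$ be a given potential on $V$, and let $\beta>0$. Let $\rho^o=(\rho^o_i)_{i=1}^N\in\mathcal{M}$ and let $\rho(t)=(\rho_i(t))_{i=1}^N:[0,\infty)\to\mathcal{M}$ be the solution, with initial value $\rho(0)=\rho^o$, of the system of ordinary differential equations (Fokker–Planck equation II) $$\frac{d\rho_i}{dt}=\sum_{j\in N(i),\,\bar\Psi_j>\bar\Psi_i}(\bar\Psi_j-\bar\Psi_i)\rho_j+\sum_{j\in N(i),\,\bar\Psi_j<\bar\Psi_i}(\bar\Psi_j-\bar\Psi_i)\rho_i,\qquad \bar\Psi_i=\Psi_i+\beta\log\rho_i,\qquad i=1,\dots,N.$$ Then for all $t\ge 0$ $$\Big\|\frac{\rho(t)}{\rho^*}-1\Big\|_{2,\rho^*}^2\le \Big\|\frac{\rho^o}{\rho^*}-1\Big\|_{2,\rho^*}^2\,e^{-Ct},\qquad C=\beta\lambda_2\,\frac{\min\{\rho^*_i:1\le i\le N\}}{\max\{\rho_i^*:1\le i\le N\}},$$ where $\rho^*$ is the Gibbs distribution and $\lambda_2$ is the spectral gap of $G$. In particular, $\rho(t)$ converges exponentially to $\rho^*$ in the Euclidean metric of $\mathbb{R}^N$ as $t\to\infty$.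
   Context: $\mathcal{M}=\{\rho=(\rho_i)_{i=1}^N\in\mathbb{R}^N:\ \sum_{i=1}^N\rho_i=1,\ \rho_i>0 \text{ for all } i\}$ is the set of positive probability distributions on $V$. $N(i)=\{j:\{a_i,a_j\}\in E\}$ is the set of indices of neighbors of $a_i$. The Gibbs distribution $\rho^*=(\rho^*_i)_{i=1}^N\in\mathcal{M}$ is $\rho_i^*=\frac1K e^{-\Psi_i/\beta}$ with $K=\sum_{i=1}^N e^{-\Psi_i/\beta}$. For $\nu,\mu\in\mathcal{M}$, $\big\|\frac{\nu}{\mu}-1\big\|_{2,\mu}^2=\sum_{i=1}^N\big(\frac{\nu_i}{\mu_i}-1\big)^2\mu_i$. The spectral gap $\lambda_2$ of $G$ is the second smallest eigenvalue of the (unnormalized) graph Laplacian matrix $\mathcal{L}(G)=D-A$, where $D$ is the diagonal matrix of vertex degrees and $A$ the adjacency matrix. *)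

(* Defs.v *)
From HB Require Import structures.
From mathcomp Require Import all_boot all_order all_algebra.
From mathcomp Require Import polyrcf.
From mathcomp Require Import all_classical all_reals all_analysis.

Set Implicit Arguments.
Unset Strict Implicit.
Unset Printing Implicit Defensive.

Import Order.TTheory GRing.Theory Num.Theory.
Import numFieldNormedType.Exports.

Local Open Scope classical_set_scope.
Local Open Scope ring_scope.

(* A graph on vertices a_1, ..., a_N is an adjacency relation on 'I_N. *)
Definition simple_graph (N : nat) (adj : rel 'I_N) : Prop :=
  symmetric adj /\ irreflexive adj.

Definition connected_graph (N : nat) (adj : rel 'I_N) : Prop :=
  forall i j : 'I_N, connect adj i j.

Definition adjacency_mx (R : realType) (N : nat) (adj : rel 'I_N) : 'M[R]_N :=
  \matrix_(i, j) (adj i j)%:R.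

Definition degree_mx (R : realType) (N : nat) (adj : rel 'I_N) : 'M[R]_N :=
  diag_mx (\row_i #|[pred j | adj i j]|%:R).

Definition laplacian_mx (R : realType) (N : nat) (adj : rel 'I_N) : 'M[R]_N :=
  degree_mx R adj - adjacency_mx R adj.

(* [rootsR p] is sorted increasingly and duplicate-free, so this lists the
   real eigenvalues in nondecreasing order, repeated according to their
   (algebraic) multiplicity. *)
Definition eigenvalue_seq (R : realType) (N : nat) (A : 'M[R]_N) : seq R :=
  flatten [seq nseq (mup x (char_poly A)) x | x <- rootsR (char_poly A)].

Definition spectral_gap (R : realType) (N : nat) (adj : rel 'I_N) : R :=
  nth 0 (eigenvalue_seq (laplacian_mx R adj)) 1.

Definition positive_distr (R : realType) (N : nat) : set 'rV[R]_N :=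
  [set rho | \sum_i rho ord0 i = 1 /\ forall i, 0 < rho ord0 i].

Definition gibbs (R : realType) (N : nat) (Psi : 'rV[R]_N) (beta : R)
    : 'rV[R]_N :=
  \row_i (expR (- Psi ord0 i / beta) / \sum_j expR (- Psi ord0 j / beta)).

(* The squared norm of nu / mu - 1 in L^2(mu). *)
Definition rel_dist2 (R : realType) (N : nat) (nu mu : 'rV[R]_N) : R :=
  \sum_i (nu ord0 i / mu ord0 i - 1) ^+ 2 * mu ord0 i.

(* The canonical norm of 'rV[R]_N is the sup norm. *)
Definition euclidean_dist (R : realType) (N : nat) (x y : 'rV[R]_N) : R :=
  Num.sqrt (\sum_i (x ord0 i - y ord0 i) ^+ 2).

Definition modified_potential (R : realType) (N : nat) (Psi : 'rV[R]_N)
    (beta : R) (rho : 'rV[R]_N) (i : 'I_N) : R :=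
  Psi ord0 i + beta * ln (rho ord0 i).

Definition fokker_planck2 (R : realType) (N : nat) (adj : rel 'I_N)
    (Psi : 'rV[R]_N) (beta : R) (rho : 'rV[R]_N) (i : 'I_N) : R :=
  let psi := modified_potential Psi beta rho in
  \sum_(j | adj i j && (psi i < psi j)) (psi j - psi i) * rho ord0 j
  + \sum_(j | adj i j && (psi j < psi i)) (psi j - psi i) * rho ord0 i.

(* A trajectory on [0, +oo) is a function on R of which only the values at
   nonnegative times matter; the derivative at 0 is the right derivative. *)
Definition fokker_planck2_solution (R : realType) (N : nat) (adj : rel 'I_N)
    (Psi : 'rV[R]_N) (beta : R) (rho0 : 'rV[R]_N) (rho : R -> 'rV[R]_N)
    : Prop :=
  [/\ rho 0 = rho0,
      forall t : R, 0 <= t -> positive_distr (rho t),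
      forall (t : R) (i : 'I_N), 0 < t ->
        is_derive t 1 (fun s => rho s ord0 i)
          (fokker_planck2 adj Psi beta (rho t) i) &
      forall i : 'I_N,
        h^-1 * (rho h ord0 i - rho 0 ord0 i) @[h --> 0^'+]
          --> fokker_planck2 adj Psi beta (rho 0) i].

(* The entries of a positive probability vector lie in (0, 1], so 1 and 0 are
   neutral for the minimum and the maximum respectively. *)
Definition min_entry (R : realType) (N : nat) (rho : 'rV[R]_N) : R :=
  \big[Num.min/1]_i rho ord0 i.

Definition max_entry (R : realType) (N : nat) (rho : 'rV[R]_N) : R :=
  \big[Num.max/0]_i rho ord0 i.

Definition decay_rate (R : realType) (N : nat) (adj : rel 'I_N)
    (Psi : 'rV[R]_N) (beta : R) : R :=
  beta * spectral_gap R adj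
  * (min_entry (gibbs Psi beta) / max_entry (gibbs Psi beta)).

(* Main.v *)
Require Import Defs.
From mathcomp Require Import all_boot all_order all_algebra.
From mathcomp Require Import polyrcf complex ring lra.
From mathcomp Require Import all_classical all_reals all_analysis.
Import Order.TTheory GRing.Theory Num.Theory.
Import numFieldNormedType.Exports.
Local Open Scope classical_set_scope.
Local Open Scope ring_scope.

(* With [eta = rho / rho^*] one has
   [psi_j - psi_i = beta (ln eta_j - ln eta_i)].  Differentiating
   [L = rel_dist2 rho rho^*] and summing by parts, an edge with
   [eta_i < eta_j] contributes
   [- 2 beta (ln eta_j - ln eta_i) eta_j rho^*_j (eta_j - eta_i)], which is at
   most [- 2 beta min(rho^* ) (eta_j - eta_i)^2] because [ln x <= x - 1].
   The Poincare inequality of the graph Laplacian, applied to [eta] minus its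
   arithmetic mean, bounds the sum over edges below by
   [lambda_2 L / max(rho^* )], since the [rho^*]-variance is at most the second
   moment about any constant.  Hence [L' <= - 2 C L].  The Poincare inequality
   and [lambda_2 > 0] come from unitary diagonalization over [R[i]]. *)

(** * Spectral gap of the Laplacian *)

Local Open Scope sesquilinear_scope.

(** Both lists are sorted, so it suffices to compare multiplicities: once the characteristic
    polynomial splits, [mup x] is the number of occurrences of [x] in [s]. *)
Lemma eigenvalue_seq_sort (R : realType) (N : nat) (A : 'M[R]_N) (s : seq R) :
  char_poly A = \prod_(y <- s) ('X - y%:P) ->
  eigenvalue_seq A = sort <=%R s.
Proof.
move=> hp; set r := rootsR (char_poly A).
have pN0 : char_poly A != 0 by rewrite monic_neq0 ?char_poly_monic.
have ltr : sorted <%R r by apply: sorted_roots.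
have countE (x : R) (t : seq R) : count_mem x
    (flatten [seq nseq (mup y (char_poly A)) y | y <- t]) =
    (count_mem x t * mup x (char_poly A))%N.
  elim: t => //= y t IH; rewrite count_cat IH count_nseq /= mulnDl.
  by case: eqVneq => [->|].
apply: (sorted_eq le_trans le_anti); last 1 first.
- rewrite perm_sym perm_sort; apply/allP => x _ /=; apply/eqP.
  rewrite /eigenvalue_seq countE [in mup _ _]hp mu_prod_XsubC.
  rewrite count_uniq_mem ?uniq_roots //.
  have := roots_on_rootsR pN0 x; rewrite in_itv /= -/r => <-.
  by rewrite [in root _ _]hp root_prod_XsubC; case: (boolP (x \in s)) =>
    [|/count_memPn ->]; rewrite ?mul1n ?mul0n.
(* Blocks are constant, and the roots increase strictly from block to block. *)
- rewrite /eigenvalue_seq -/r; elim: r ltr => //= y t IH.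
  rewrite (path_sortedE lt_trans) => /andP[yt /IH st].
  elim: (mup y _) => //= n.
  rewrite !(path_sortedE le_trans) => ->;
    rewrite andbT all_cat all_nseq lexx orbT /=.
  apply/allP => z /flattenP [u /mapP [w wt ->]] /nseqP [-> _].
  exact/ltW/(allP yt).
- exact: (sort_sorted le_total).
Qed.

(* The eigenvalue that may fail to dominate [spectral_gap] sits at [i0]. *)
Lemma spectral_gapP {R : realType} {N : nat} {adj : rel 'I_N} {d : 'I_N -> R} :
  (2 <= N)%N ->
  char_poly (laplacian_mx R adj) = \prod_i ('X - (d i)%:P) ->
  exists i0 i1 : 'I_N, [/\ i0 != i1, d i0 <= d i1, d i1 = spectral_gap R adj &
    forall i, i != i0 -> spectral_gap R adj <= d i].
Proof.
move=> hN hp.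
(* Sorting indices instead of values keeps the first two positions distinct even when their
   eigenvalues coincide. *)
have hs : eigenvalue_seq (laplacian_mx R adj) =
    [seq d i | i <- sort (relpre d <=%R) (enum 'I_N)].
  rewrite (@map_sort _ _ d (relpre d <=%R) <=%R) //; apply: eigenvalue_seq_sort.
  by rewrite big_map big_enum.
rewrite /spectral_gap hs.
have : size (sort (relpre d <=%R) (enum 'I_N)) = N
  by rewrite size_sort size_enum_ord.
have : uniq (sort (relpre d <=%R) (enum 'I_N)) by rewrite sort_uniq enum_uniq.
have : sorted (relpre d <=%R) (sort (relpre d <=%R) (enum 'I_N)).
  by apply: sort_sorted => i j; exact: le_total.
have : forall i, i \in sort (relpre d <=%R) (enum 'I_N).
  by move=> i; rewrite mem_sort mem_enum.
case: (sort _ _) => [|i0 [|i1 t]] hmem srt un sz; [by rewrite -sz in hN..|].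
exists i0, i1; move: srt un => /= /andP[h01 srt] /andP[un _].
split=> //; first by apply: contraNneq un => ->; rewrite inE eqxx.
move=> i i0i; have := hmem i; rewrite inE (negbTE i0i) /= inE.
case/orP => [/eqP->//|it].
by move: srt; rewrite path_sortedE => [/andP[/allP/(_ i it)]//|];
  move=> ? ? ?; exact: le_trans.
Qed.

(** * Unitary diagonalization of real symmetric matrices *)

Lemma char_poly_conj (F : fieldType) (n : nat) (P D : 'M[F]_n) :
  P \in unitmx -> char_poly (invmx P *m D *m P) = char_poly D.
Proof.
move=> Pu; set Q := map_mx polyC P; set Q' := map_mx polyC (invmx P).
have QK : Q' *m Q = 1%:M by rewrite -map_mxM mulVmx // map_mx1.
rewrite /char_poly.
have -> : char_poly_mx (invmx P *m D *m P) = Q' *m char_poly_mx D *m Q.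
  by rewrite /char_poly_mx mulmxBr mulmxBl scalar_mxC -(mulmxA _ Q') QK mulmx1
    !map_mxM.
by rewrite !det_mulmx mulrAC -det_mulmx QK det1 mul1r.
Qed.

(** Over [R[i]] the matrix is Hermitian, so its eigenvalues are real; the factorization descends to
    [R] because the embedding of polynomials is injective. *)
Lemma symmetric_spectral {R : realType} {n : nat} {A : 'M[R]_n} :
  A^T = A ->
  exists (P : 'M[R[i]]_n) (d : 'I_n -> R),
    [/\ P \is unitarymx,
        map_mx (real_complex R) A =
          P^t* *m diag_mx (\row_i (real_complex R (d i))) *m P &
        char_poly A = \prod_i ('X - (d i)%:P)].
Proof.
move=> sA; set B := map_mx (real_complex R) A.
have hB : B \is hermsymmx.
  apply: realsym_hermsym.
    apply/is_hermitianmxP/matrixP => i j.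
    by rewrite expr0 scale1r !mxE -[in LHS]sA mxE.
  by apply/mxOverP => i j; rewrite mxE; apply/complex_realP; exists (A i j).
have /orthomx_spectralP := hermitian_normalmx hB.
have := spectral_unitarymx B; have := hermitian_spectral_diag_real hB.
set P := spectralmx B; set D := spectral_diag B => hD hP.
rewrite invmx_unitary // => eB.
pose d i := complex.Re (D 0 i).
have Dd : D = \row_i (real_complex R (d i)).
  by apply/rowP => i; rewrite mxE /d RRe_real // (mxOverP hD).
exists P, d; split => //; first by rewrite -Dd.
apply: (@map_poly_inj _ _ (real_complex R)).
rewrite map_char_poly -/B eB -invmx_unitary //.
have Pu := unitarymx_unit hP.
have -> : char_poly (invmx P *m diag_mx D *m P) = char_poly (diag_mx D).
  exact: char_poly_conj.
rewrite char_poly_trig ?diag_mx_is_trig // rmorph_prod.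
by apply: eq_bigr => i _;
  rewrite Dd !mxE eqxx mulr1n rmorphB /= map_polyX map_polyC.
Qed.

(** * Dirichlet form and Poincare inequality *)

Lemma laplacian_sym {R : realType} {N : nat} {adj : rel 'I_N} :
  symmetric adj -> (laplacian_mx R adj)^T = laplacian_mx R adj.
Proof.
move=> sadj; rewrite /laplacian_mx /degree_mx linearB /= tr_diag_mx.
by congr (_ - _); apply/matrixP => i j; rewrite !mxE sadj.
Qed.

(** The sum runs over ordered pairs, so each edge counts twice. Complex vectors are allowed because
    the form is also evaluated at rows of a unitary matrix. *)
Lemma laplacian_quadratic_form {R : realType} {N : nat} {adj : rel 'I_N}
    (x : 'rV[R[i]]_N) :
  symmetric adj ->
  (x *m map_mx (real_complex R) (laplacian_mx R adj) *m x^t*) 0 0 *+ 2 =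
  \sum_i \sum_(j | adj i j) `|x 0 i - x 0 j| ^+ 2.
Proof.
move=> sadj.
have -> : (x *m map_mx (real_complex R) (laplacian_mx R adj) *m x^t*) 0 0 =
  \sum_i \sum_(j | adj i j) (x 0 i * (x 0 i)^* - x 0 i * (x 0 j)^*).
  rewrite mxE (eq_bigr (fun k =>
    \sum_j x 0 j * real_complex R (laplacian_mx R adj j k) * (x 0 k)^*)); last first.
    by move=> k _; rewrite !mxE big_distrl /=; apply: eq_bigr => j _;
      rewrite !mxE.
  rewrite exchange_big; apply: eq_bigr => i _ /=.
  rewrite sumrB sumr_const.
  under eq_bigr => k _ do rewrite !mxE rmorphB rmorphMn /= mulrBr mulrBl.
  rewrite sumrB; congr (_ - _).
    rewrite (bigD1 i) //= eqxx mulr1n big1 ?addr0.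
      by rewrite rmorph_nat mulr_natr mulrnAl.
    by move=> k /negbTE; rewrite eq_sym => ->; rewrite mulr0n mulr0 mul0r.
  rewrite [RHS]big_mkcond; apply: eq_bigr => k _.
  by rewrite rmorph_nat; case: (adj i k); rewrite ?mulr1 ?mulr0 ?mul0r.
(* The second copy is taken with the endpoints exchanged, which completes the squared modulus. *)
rewrite mulr2n [X in _ + X](_ : _ =
  \sum_i \sum_(j | adj i j) (x 0 j * (x 0 j)^* - x 0 j * (x 0 i)^*));
    last first.
  by rewrite (exchange_big_dep xpredT) //=; apply: eq_bigr => i _;
    apply: eq_bigl => j; rewrite sadj.
rewrite -big_split; apply: eq_bigr => i _; rewrite -big_split;
  apply: eq_bigr => j _ /=.
by rewrite normCK rmorphB /= mulrBl !mulrBr; ring.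
Qed.

Lemma conj_real_complex {R : rcfType} (x : R) :
  (real_complex R x)^* = real_complex R x.
Proof. exact: conjc_real. Qed.

Lemma unitary_quadratic_form {C : numClosedFieldType} {n : nat}
    {P : 'M[C]_n} {D : 'rV[C]_n} (x : 'rV[C]_n) :
  (x *m (P^t* *m diag_mx D *m P) *m x^t*) 0 0 =
  \sum_i D 0 i * `|(x *m P^t*) 0 i| ^+ 2.
Proof.
set y := x *m P^t*.
have -> : x *m (P^t* *m diag_mx D *m P) *m x^t* = y *m diag_mx D *m y^t*.
  by rewrite /y trmx_mul map_mxM trmxCK !mulmxA.
rewrite mxE; apply: eq_bigr => i _.
by rewrite mul_mx_diag !mxE normCK mulrAC mulrC mulrA.
Qed.

Lemma laplacian_poincare {R : realType} {N : nat} {adj : rel 'I_N}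
    (x : 'I_N -> R) :
  (2 <= N)%N -> symmetric adj -> \sum_i x i = 0 ->
  (spectral_gap R adj * \sum_i x i ^+ 2) *+ 2 <=
  \sum_i \sum_(j | adj i j) (x i - x j) ^+ 2.
Proof.
move=> hN sadj x0.
have RHS0 : 0 <= \sum_i \sum_(j | adj i j) (x i - x j) ^+ 2.
  by do 2 (apply: sumr_ge0 => ? _); exact: sqr_ge0.
have S0 : 0 <= \sum_i x i ^+ 2 by apply: sumr_ge0 => ? _; exact: sqr_ge0.
(* A nonpositive gap makes the left side nonpositive. A positive one confines the kernel to the
   coordinate [i0]. *)
have [g0|g0] := leP (spectral_gap R adj) 0.
  by apply: le_trans RHS0; rewrite pmulrn_lle0 // mulr_le0_ge0.
have [P [d [/unitarymxP hP eL hchar]]] :=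
  symmetric_spectral (laplacian_sym (R := R) sadj).
have PP : P^t* *m P = 1%:M by rewrite (mulmx1C hP).
have [i0 [i1 [i01 d01 d1 hd]]] := spectral_gapP hN hchar.
pose z : 'rV[R[i]]_N := \row_i real_complex R (x i).
pose y := z *m P^t*.
pose e : 'rV[R[i]]_N := const_mx 1.
pose f := e *m P^t*.
have eL0 : e *m map_mx (real_complex R) (laplacian_mx R adj) = 0.
  apply/rowP => k; rewrite !mxE;
    under eq_bigr => j _ do rewrite !mxE mul1r rmorphB.
  rewrite sumrB (bigD1 k) //= eqxx mulr1n big1 ?addr0; last first.
    by move=> j /negbTE ->; rewrite rmorph0.
  rewrite rmorph_nat -rmorph_sum -natr_sum rmorph_nat.
  rewrite -sum1_card big_mkcond /=; apply/eqP; rewrite subr_eq0; apply/eqP.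
  by congr (_%:R); apply: eq_bigr => j _; rewrite inE sadj; case: (adj j k).
(* The all-ones vector [e] lies in the kernel, so [i0] carries its only nonzero
   spectral coordinate; orthogonality to [e] then forces [y 0 i0 = 0]. *)
have fD i : f 0 i * real_complex R (d i) = 0.
  have : (f *m diag_mx (\row_i real_complex R (d i))) 0 i = 0.
    have -> : f *m diag_mx (\row_i real_complex R (d i)) =
        e *m map_mx (real_complex R) (laplacian_mx R adj) *m P^t*.
      by rewrite eL !mulmxA -(mulmxA _ P) hP mulmx1.
    by rewrite eL0 mul0mx mxE.
  by rewrite mul_mx_diag !mxE.
have fi i : i != i0 -> f 0 i = 0.
  move=> ii0; have /eqP := fD i; rewrite mulf_eq0 => /orP[/eqP//|].
  by rewrite fmorph_eq0 gt_eqF // (lt_le_trans g0) // hd.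
have fP : f *m P = e by rewrite -mulmxA PP mulmx1.
(* If this coordinate vanished too, [f] and hence [e = f *m P] would be zero. *)
have f0 : f 0 i0 != 0.
  apply: contraTneq (oner_neq0 R[i]) => fi0.
  have f00 : f = 0.
    by apply/rowP => i; rewrite [RHS]mxE; have [->|/fi//] := eqVneq i i0.
  have := fP; rewrite f00 mul0mx => /rowP/(_ i0); rewrite !mxE => <-.
  by rewrite eqxx.
have yi0 : y 0 i0 = 0.
  have : (f *m y^t*) 0 0 = 0.
    rewrite /y trmx_mul map_mxM trmxCK mulmxA fP mxE.
    rewrite (eq_bigr (fun k => real_complex R (x k))) -?rmorph_sum ?x0
      ?rmorph0 //.
    by move=> k _; rewrite !mxE mul1r; exact: conj_real_complex.
  rewrite mxE (bigD1 i0) //= big1 ?addr0; last first.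
    by move=> i /fi ->; rewrite mul0r.
  rewrite (_ : (y^t*) i0 0 = (y 0 i0)^*); last by rewrite [LHS]mxE [in LHS]mxE.
  by move/eqP; rewrite mulf_eq0 (negbTE f0) conjC_eq0 => /eqP.
(* Parseval's identity for the unitary change of coordinates. *)
have zz : \sum_i `|y 0 i| ^+ 2 = real_complex R (\sum_i x i ^+ 2).
  have -> : \sum_i `|y 0 i| ^+ 2 = (y *m y^t*) 0 0.
    by rewrite mxE; apply: eq_bigr => i _; rewrite normCK !mxE.
  rewrite /y trmx_mul map_mxM trmxCK mulmxA -(mulmxA z) PP mulmx1 mxE
    rmorph_sum.
  by apply: eq_bigr => i _; rewrite !mxE rmorphXn expr2; congr (_ * _);
    exact: conj_real_complex.
have := laplacian_quadratic_form z sadj.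
rewrite eL unitary_quadratic_form -/y => key.
rewrite -lecR.
have <- : \sum_i \sum_(j | adj i j) `|z 0 i - z 0 j| ^+ 2 =
   real_complex R (\sum_i \sum_(j | adj i j) (x i - x j) ^+ 2).
  rewrite rmorph_sum; apply: eq_bigr => i _; rewrite rmorph_sum;
    apply: eq_bigr => j _.
  by rewrite !mxE -rmorphB rmorphXn normCK /= conj_real_complex expr2.
rewrite -key rmorphMn /= lerMn2r rmorphM /= -zz mulr_sumr ler_sum // => i _.
have [->|ii0] := eqVneq i i0; first by rewrite yi0 normr0 expr0n /= !mulr0.
by rewrite ler_wpM2r ?exprn_ge0 // mxE lecR hd.
Qed.

Lemma spectral_gap_gt0 {R : realType} {N : nat} {adj : rel 'I_N} :
  (2 <= N)%N -> symmetric adj -> connected_graph adj -> 0 < spectral_gap R adj.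
Proof.
move=> hN sadj conn; rewrite ltNge; apply/negP => g0.
have [P [d [/unitarymxP hP eL hchar]]] :=
  symmetric_spectral (laplacian_sym (R := R) sadj).
have [i0 [i1 [i01 d01 d1 _]]] := spectral_gapP hN hchar.
(* Eigenvectors of nonpositive eigenvalue are constant, so two of them cannot be
   orthogonal. *)
have Pconst i : d i <= 0 -> forall k l, P i k = P i l.
  move=> di k l.
  have := laplacian_quadratic_form (row i P) sadj.
  rewrite eL unitary_quadratic_form -row_mul hP row1.
  rewrite (bigD1 i) //= big1 ?addr0; last first.
    by move=> j /negbTE ji; rewrite !mxE eqxx /= ji normr0 expr0n mulr0.
  rewrite !mxE !eqxx normr1 expr1n mulr1 => hs.
  (* The sum equals twice [d i], since the row has norm one; being nonnegative and nonpositive, it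
     vanishes term by term, and constancy spreads along paths. *)
  have s0 : \sum_k \sum_(l | adj k l) `|row i P 0 k - row i P 0 l| ^+ 2 = 0.
    apply/le_anti/andP; split; last by do 2 (apply: sumr_ge0 => ? _);
      exact: exprn_ge0.
    by rewrite -hs pmulrn_lle0 // lecR.
  have adjP a b : adj a b -> P i a = P i b.
    have ge0 (k' l' : 'I_N) : 0 <= `|row i P 0 k' - row i P 0 l'| ^+ 2 :> R[i].
      exact: exprn_ge0.
    move=> ab.
    have sa := psumr_eq0P
      (fun k' _ => sumr_ge0 _ (fun l' _ => ge0 k' l')) s0 (i := a) isT.
    have := psumr_eq0P (fun l' _ => ge0 a l') sa (i := b) ab.
    by move/eqP; rewrite expf_eq0 /= normr_eq0 subr_eq0 !mxE => /eqP.
  have /connectP[p pth ->] := conn k l.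
  by elim: p k pth => //= b p IH k /andP[/adjP -> /IH].
(* A constant row with a zero entry would vanish, against its unit norm. *)
have nz i : d i <= 0 -> forall k, P i k != 0.
  move=> di k; apply/eqP => Pk; have /matrixP/(_ i i) := hP.
  rewrite !mxE eqxx big1 => [/eqP|j _]; first by rewrite eq_sym oner_eq0.
  by rewrite (Pconst i di j k) Pk mul0r.
have d1' : d i1 <= 0 by rewrite d1.
have d0' := le_trans d01 d1'.
have /matrixP/(_ i0 i1) := hP; rewrite !mxE (negbTE i01) /=.
(* The inner product of the two constant rows is [N] times a product of nonzero constants. *)
rewrite (eq_bigr (fun=> P i0 i0 * (P i1 i0)^*)); last first.
  by move=> k _; rewrite !mxE (Pconst _ d0' k i0) (Pconst _ d1' k i0).
rewrite sumr_const card_ord => /eqP; rewrite mulrn_eq0 mulf_eq0 conjC_eq0.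
by rewrite (negbTE (nz _ d0' _)) (negbTE (nz _ d1' _)) orbF;
  rewrite -leqn0 leqNgt (ltnW hN).
Qed.

Local Close Scope sesquilinear_scope.

(** * Differential inequality *)

(** For [h > 0], [f h] is [h] times the quotient plus [f 0]. This gives continuity at the initial
    time, where only a one-sided derivative is available. *)
Lemma cvg_right_of_quotient {R : realType} {f : R -> R} {l : R} :
  h^-1 * (f h - f 0) @[h --> 0^'+] --> l -> f h @[h --> 0^'+] --> f 0.
Proof.
move=> hl.
have h0 : (h : R) @[h --> 0^'+] --> (0 : R).
  by apply: cvg_at_right_filter; exact: cvg_id.
have : (h * (h^-1 * (f h - f 0)) + f 0) @[h --> 0^'+] --> 0 * l + f 0.
  by apply: cvgD; [exact: cvgM|exact: cvg_cst].
rewrite mul0r add0r; apply: cvg_trans; apply: near_eq_cvg.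
near=> h; have hgt0 : 0 < h by near: h; exact: nbhs_right_gt.
by rewrite mulrA divff ?gt_eqF // mul1r subrK.
Unshelve. all: by end_near. Qed.

Lemma is_derive_continuous {R : realType} {f : R -> R} {x df : R} :
  is_derive x 1 f df -> {for x, continuous f}.
Proof.
move=> fx; apply: differentiable_continuous; apply/derivable1_diffP.
exact: (@ex_derive _ _ _ _ _ _ _ fx).
Qed.

(** Integrating factor: [f t * expR (c * t)] has nonpositive derivative for [t > 0], and right
    continuity at 0 brings in the initial value. *)
Lemma gronwall_decay {R : realType} {f df : R -> R} {c : R} :
  (forall t : R, 0 < t -> is_derive t 1 f (df t)) ->
  f h @[h --> 0^'+] --> f 0 ->
  (forall t : R, 0 < t -> df t <= - c * f t) ->
  forall t : R, 0 <= t -> f t <= f 0 * expR (- c * t).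
Proof.
move=> fd f0 fle t t0.
pose g : R -> R := f * (fun s => expR (c * s)).
have ed (s : R) : is_derive s 1 (fun s => expR (c * s)) (expR (c * s) * c).
  apply: (@is_derive1_comp _ expR (fun s => c * s)).
  by have := is_deriveZ c (is_derive_id s (1 : R));
    rewrite /GRing.scale /= mulr1.
have gd (s : R) : 0 < s -> is_derive s 1 g (expR (c * s) * (df s + c * f s)).
  move=> s0; have := is_deriveM (fd s s0) (ed s).
  by rewrite /GRing.scale /=; congr is_derive; ring.
have : g t <= g 0.
  apply: (@ler0_derive1_nincry _ g 0) => //.
  - by move=> s; rewrite in_itv /= andbT => s0;
      exact: (@ex_derive _ _ _ _ _ _ _ (gd s s0)).
  - move=> s; rewrite in_itv /= andbT => s0.
    rewrite derive1E (@derive_val _ _ _ _ _ _ _ (gd s s0)).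
    by rewrite pmulr_rle0 ?expR_gt0 // -lerBrDr sub0r -mulNr fle.
  - apply/continuous_within_itvcyP; split.
      move=> s; rewrite in_itv /= andbT => s0.
      exact: is_derive_continuous (gd s s0).
    apply: cvgM => //; apply: cvg_at_right_filter.
    exact: is_derive_continuous (ed 0).
have gE s : g s = f s * expR (c * s) by [].
rewrite !gE mulr0 expR0 mulr1 => gt.
by rewrite mulNr expRN ler_pdivlMr ?expR_gt0.
Qed.

(** * Gibbs distribution and dissipation estimates *)

Lemma gibbs_partition_gt0 {R : realType} {N : nat} (Psi : 'rV[R]_N) (beta : R) :
  (0 < N)%N -> 0 < \sum_j expR (- Psi ord0 j / beta).
Proof.
case: N Psi => // N Psi _; rewrite big_ord_recl ltr_pwDl ?expR_gt0 //.
by apply: sumr_ge0 => i _; exact: expR_ge0.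
Qed.

Lemma gibbs_positive_distr {R : realType} {N : nat} (Psi : 'rV[R]_N)
    (beta : R) :
  (0 < N)%N -> positive_distr (gibbs Psi beta).
Proof.
move=> N0; have K0 := gibbs_partition_gt0 Psi beta N0; split.
  under eq_bigr => i _ do rewrite mxE.
  by rewrite -mulr_suml divff ?gt_eqF.
by move=> i; rewrite mxE divr_gt0 ?expR_gt0.
Qed.

Lemma positive_distr_le1 {R : realType} {N : nat} {rho : 'rV[R]_N} :
  positive_distr rho -> forall i, rho ord0 i <= 1.
Proof.
move=> [<- rho0] i; rewrite (bigD1 i) //= lerDl.
by apply: sumr_ge0 => j _; exact: ltW.
Qed.

Lemma min_entry_gt0 {R : realType} {N : nat} {rho : 'rV[R]_N} :
  positive_distr rho -> 0 < min_entry rho.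
Proof. by move=> [_ rho0]; apply: lt_bigmin. Qed.

(** The logarithm of a Gibbs weight is [- Psi / beta] minus the logarithm of the partition function,
    which cancels in the difference. *)
Lemma modified_potentialB {R : realType} {N : nat} {Psi : 'rV[R]_N} {beta : R}
    {rho : 'rV[R]_N} (i j : 'I_N) :
  beta != 0 -> (forall k, 0 < rho ord0 k) ->
  modified_potential Psi beta rho j - modified_potential Psi beta rho i =
  beta * (ln (rho ord0 j / gibbs Psi beta ord0 j)
          - ln (rho ord0 i / gibbs Psi beta ord0 i)).
Proof.
move=> b0 rho0; have N0 : (0 < N)%N by apply: leq_ltn_trans (ltn_ord i).
have K0 := gibbs_partition_gt0 Psi beta N0.
have [_ mu0] := gibbs_positive_distr Psi beta N0.
have lnmu k : ln (gibbs Psi beta ord0 k) =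
    - Psi ord0 k / beta - ln (\sum_j expR (- Psi ord0 j / beta)).
  by rewrite mxE ln_div ?posrE ?expR_gt0 // expRK.
by rewrite !ln_div ?posrE // !lnmu /modified_potential; field.
Qed.

(** Discrete integration by parts: what enters [i] from [j] leaves [j], so exchanging the outflow
    sum pairs both terms on one oriented edge. The flux carries the density at the end of higher
    potential. *)
Lemma fokker_planck2_weak {R : realType} {N : nat} {adj : rel 'I_N}
    {Psi : 'rV[R]_N} {beta : R} {rho : 'rV[R]_N} (phi : 'I_N -> R) :
  symmetric adj ->
  let psi := modified_potential Psi beta rho in
  \sum_i phi i * fokker_planck2 adj Psi beta rho i =
  - \sum_i \sum_(j | adj i j && (psi i < psi j))
      (psi j - psi i) * rho ord0 j * (phi j - phi i).
Proof.
move=> sadj psi.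
under eq_bigr => i _ do rewrite /fokker_planck2 -/psi mulrDr !mulr_sumr.
rewrite big_split /= [X in _ + X](exchange_big_dep xpredT) //= -big_split
  -sumrN.
apply: eq_bigr => i _ /=.
rewrite [X in _ + X](eq_bigl (fun j => adj i j && (psi i < psi j))); last first.
  by move=> j; rewrite sadj.
rewrite -big_split -sumrN; apply: eq_bigr => j _ /=; ring.
Qed.

(** Multiply [ln (a / b) <= a / b - 1] by [b]; the factor [b] is the density ratio at the end of
    higher potential. *)
Lemma edge_flux_ge {R : realType} {a b : R} :
  0 < a -> a < b -> b - a <= (ln b - ln a) * b.
Proof.
move=> a0 ab; have b0 := lt_trans a0 ab.
have : ln (a / b) <= a / b - 1.
  have := @le_ln1Dx _ (a / b - 1); rewrite [1 + _]addrC subrK; apply.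
  by rewrite -subr_gt0 opprK subrK divr_gt0.
rewrite ln_div ?posrE // => h.
have : (ln a - ln b) * b <= (a / b - 1) * b by rewrite ler_wpM2r // ltW.
rewrite mulrBl mulrBl divfK ?gt_eqF //; lra.
Qed.

(** An edge with distinct values has one ascending orientation but appears in both on the right;
    ties contribute zero. *)
Lemma sum_sqr_ordered {R : realType} {N : nat} {adj : rel 'I_N}
    (eta : 'I_N -> R) :
  symmetric adj ->
  (\sum_i \sum_(j | adj i j && (eta i < eta j)) (eta j - eta i) ^+ 2) *+ 2 =
  \sum_i \sum_(j | adj i j) (eta i - eta j) ^+ 2.
Proof.
move=> sadj.
rewrite mulr2n {2}(exchange_big_dep xpredT) //= -big_split.
apply: eq_bigr => i _ /=;
  rewrite !big_mkcond [in X in _ + X]big_mkcond -big_split /=.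
rewrite [RHS]big_mkcond; apply: eq_bigr => j _; rewrite (sadj j i).
case: (adj i j) => /=; last by rewrite addr0.
by case: ltgtP => [_|_|->];
  rewrite ?addr0 ?add0r ?subrr ?expr0n // -sqrrN opprB.
Qed.

(** Under [mu] the ratio [nu / mu] has mean 1, so moving the centre to [a] adds exactly
    [(1 - a) ^+ 2]. *)
Lemma rel_dist2_center {R : realType} {N : nat} {nu mu : 'rV[R]_N} (a : R) :
  positive_distr nu -> positive_distr mu ->
  rel_dist2 nu mu <= \sum_i (nu ord0 i / mu ord0 i - a) ^+ 2 * mu ord0 i.
Proof.
move=> [nu1 _] [mu1 mu0].
have -> : \sum_i (nu ord0 i / mu ord0 i - a) ^+ 2 * mu ord0 i =
    rel_dist2 nu mu + (1 - a) ^+ 2.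
  (* The inserted middle term is zero, as both masses are 1; with it the identity holds summand by
     summand. *)
  have -> : rel_dist2 nu mu + (1 - a) ^+ 2 = rel_dist2 nu mu
      + 2 * (1 - a) * (\sum_i nu ord0 i - \sum_i mu ord0 i)
      + (1 - a) ^+ 2 * \sum_i mu ord0 i by rewrite nu1 mu1; ring.
  rewrite -sumrB !mulr_sumr -!big_split; apply: eq_bigr => i _ /=.
  by field; rewrite gt_eqF.
by rewrite lerDl sqr_ge0.
Qed.

Lemma max_entry_gt0 {R : realType} {N : nat} {rho : 'rV[R]_N} :
  (0 < N)%N -> positive_distr rho -> 0 < max_entry rho.
Proof.
move=> N0 [_ rho0]; apply: lt_le_trans (rho0 (Ordinal N0)) _.
exact: le_bigmax.
Qed.

(** The graph inequality asks for zero unweighted mean, hence the arithmetic mean [a] as centre;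
    [rel_dist2_center] handles the change of centre, and [mu_i <= max_entry mu] the change of
    weights. *)
Lemma rel_dist2_poincare {R : realType} {N : nat} {adj : rel 'I_N}
    {nu mu : 'rV[R]_N} :
  (2 <= N)%N -> symmetric adj -> connected_graph adj ->
  positive_distr nu -> positive_distr mu ->
  spectral_gap R adj / max_entry mu * rel_dist2 nu mu *+ 2 <=
  \sum_i \sum_(j | adj i j)
    (nu ord0 i / mu ord0 i - nu ord0 j / mu ord0 j) ^+ 2.
Proof.
move=> hN sadj conn nuP muP; have N0 := ltnW hN.
have M0 := max_entry_gt0 N0 muP;
  have gap0 := spectral_gap_gt0 (R := R) hN sadj conn.
pose a : R := (\sum_i nu ord0 i / mu ord0 i) / N%:R.
have x0 : \sum_i (nu ord0 i / mu ord0 i - a) = 0.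
  rewrite sumrB sumr_const card_ord -mulr_natr divfK ?subrr //.
  by rewrite pnatr_eq0 -lt0n.
have := laplacian_poincare _ hN sadj x0.
under [X in _ <= X -> _]eq_bigr => i _ do
  (under eq_bigr => j _ do rewrite opprB addrA subrK).
apply: le_trans; rewrite lerMn2r /= -mulrA ler_pM2l // mulrC ler_pdivrMr //
  mulr_suml.
apply: le_trans (rel_dist2_center a nuP muP) _.
by apply: ler_sum => i _; rewrite ler_wpM2l ?sqr_ge0 // le_bigmax.
Qed.

(** The left side is the derivative of [rel_dist2] along the flow, bounded edge by edge after
    summation by parts. *)
Lemma fokker_planck2_dissipation {R : realType} {N : nat} {adj : rel 'I_N}
    {Psi : 'rV[R]_N} {beta : R} {rho : 'rV[R]_N} :
  let mu := gibbs Psi beta in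
  symmetric adj -> 0 < beta -> (forall i, 0 < rho ord0 i) ->
  (\sum_i (rho ord0 i / mu ord0 i - 1)
    * fokker_planck2 adj Psi beta rho i) *+ 2 <=
  - (beta * min_entry mu * \sum_i \sum_(j | adj i j)
      (rho ord0 i / mu ord0 i - rho ord0 j / mu ord0 j) ^+ 2).
Proof.
move=> mu sadj b0 rho0; pose eta i := rho ord0 i / mu ord0 i.
rewrite (fokker_planck2_weak (fun i => eta i - 1) sadj).
rewrite -(sum_sqr_ordered eta sadj) mulNrn lerN2 mulrnAr lerMn2r /= mulr_sumr.
apply: ler_sum => i _; rewrite mulr_sumr.
have muP := gibbs_positive_distr Psi beta (leq_ltn_trans (leq0n i) (ltn_ord i)).
have [_ mu0] := muP; have m0 := min_entry_gt0 muP.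
have eta0 k : 0 < eta k by rewrite divr_gt0.
(* Since [beta > 0] and [ln] is increasing, ordering an edge by potential or by [eta] is the
   same. *)
rewrite [leRHS](eq_bigl (fun j => adj i j && (eta i < eta j))); last first.
  move=> j; rewrite -subr_gt0 modified_potentialB ?gt_eqF // pmulr_rgt0 //.
  by rewrite subr_gt0 ltr_ln ?posrE; [|exact: eta0..].
apply: ler_sum => j /andP[_ ij].
rewrite modified_potentialB ?gt_eqF // -/(eta i) -/(eta j).
have -> : rho ord0 j = eta j * mu ord0 j by rewrite divfK // gt_eqF.
have h := edge_flux_ge (eta0 i) ij;
  have mj : min_entry mu <= mu ord0 j by exact: bigmin_le.
have d0 : 0 < eta j - eta i by rewrite subr_gt0.
have key : (eta j - eta i) * min_entry mu <=
    (ln (eta j) - ln (eta i)) * eta j * mu ord0 j.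
  by apply: ler_pM => //; exact: ltW.
have := ler_wpM2l (ltW b0) (ler_wpM2r (ltW d0) key).
by congr (_ <= _); ring.
Qed.

(** * Evolution of the weighted distance *)

Lemma rel_dist2_derive {R : realType} {N : nat} {mu : 'rV[R]_N}
    {rho : R -> 'rV[R]_N} {drho : 'I_N -> R} {t : R} :
  (forall i, 0 < mu ord0 i) ->
  (forall i, is_derive t 1 (fun s => rho s ord0 i) (drho i)) ->
  is_derive t 1 (fun s => rel_dist2 (rho s) mu)
    ((\sum_i (rho t ord0 i / mu ord0 i - 1) * drho i) *+ 2).
Proof.
move=> mu0 rhod.
have -> : (fun s => rel_dist2 (rho s) mu) =
    \sum_i (fun s : R => (rho s ord0 i / mu ord0 i - 1) ^+ 2 * mu ord0 i).
  by apply/funext => s; rewrite fct_sumE.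
rewrite -sumrMnl; apply: is_derive_sum => i.
have h1 := is_deriveZ (mu ord0 i)^-1 (rhod i).
have h2 := is_deriveD h1 (is_derive_cst (-1 : R) t 1).
have h3 := is_deriveZ (mu ord0 i) (is_deriveX 2 h2).
move: h3; congr is_derive.
- apply/funext => s.
  change (mu ord0 i * ((mu ord0 i)^-1 * rho s ord0 i - 1) ^+ 2 =
    (rho s ord0 i / mu ord0 i - 1) ^+ 2 * mu ord0 i).
  by rewrite mulrC [_^-1 * _]mulrC.
- change (mu ord0 i * (2 * ((mu ord0 i)^-1 * rho t ord0 i - 1) *
      ((mu ord0 i)^-1 * drho i + 0)) =
    (rho t ord0 i / mu ord0 i - 1) * drho i *+ 2).
  by field; rewrite gt_eqF.
Qed.

Lemma rel_dist2_right_cvg {R : realType} {N : nat} {mu : 'rV[R]_N}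
    {rho : R -> 'rV[R]_N} :
  (forall i, rho h ord0 i @[h --> 0^'+] --> rho 0 ord0 i) ->
  rel_dist2 (rho h) mu @[h --> 0^'+] --> rel_dist2 (rho 0) mu.
Proof.
move=> rho0; rewrite /rel_dist2.
apply: cvg_big => [|i _]; first exact: add_continuous.
apply: cvgM; last exact: cvg_cst.
have h : (rho h ord0 i / mu ord0 i - 1) @[h --> 0^'+] -->
    rho 0 ord0 i / mu ord0 i - 1.
  by apply: cvgB; [apply: cvgM; [exact: rho0|exact: cvg_cst]|exact: cvg_cst].
by rewrite expr2; under eq_cvg => ? do rewrite expr2; exact: cvgM.
Qed.

(** Entrywise [(nu - mu) ^+ 2] is [(nu / mu - 1) ^+ 2 * mu ^+ 2], and one factor [mu] is at most
    1. *)
Lemma euclidean_dist_le {R : realType} {N : nat} {nu mu : 'rV[R]_N} :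
  positive_distr mu -> euclidean_dist nu mu <= Num.sqrt (rel_dist2 nu mu).
Proof.
move=> muP; have [_ mu0] := muP; apply: ler_wsqrtr; apply: ler_sum => i _.
have mi := mu0 i.
have -> : (nu ord0 i - mu ord0 i) ^+ 2 =
    (nu ord0 i / mu ord0 i - 1) ^+ 2 * mu ord0 i * mu ord0 i.
  by field; rewrite gt_eqF.
by rewrite ler_piMr ?(positive_distr_le1 muP) // mulr_ge0 ?sqr_ge0 // ltW.
Qed.

Theorem theorem3p5 (R : realType) (N : nat) (hN : (2 <= N)%N)
  (adj : rel 'I_N) (hG : simple_graph adj) (hconn : connected_graph adj)
  (Psi : 'rV[R]_N) (beta : R) (hbeta : 0 < beta)
  (rho0 : 'rV[R]_N) (hrho0 : positive_distr rho0)
  (rho : R -> 'rV[R]_N)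
  (hrho : fokker_planck2_solution adj Psi beta rho0 rho) :
  (forall t : R, 0 <= t ->
     rel_dist2 (rho t) (gibbs Psi beta)
     <= rel_dist2 rho0 (gibbs Psi beta)
        * expR (- decay_rate adj Psi beta * t))
  /\ (exists M c : R, 0 < c /\
       forall t : R, 0 <= t ->
         euclidean_dist (rho t) (gibbs Psi beta) <= M * expR (- c * t)).
Proof.
have [sadj _] := hG; have [<- rhoP rhod rhor] := hrho; have N0 := ltnW hN.
have muP := gibbs_positive_distr Psi beta N0; have [_ mu0] := muP.
have m0 := min_entry_gt0 muP; have M0 := max_entry_gt0 N0 muP.
have gap0 := spectral_gap_gt0 (R := R) hN sadj hconn.
have C0 : 0 < decay_rate adj Psi beta by rewrite !mulr_gt0 ?invr_gt0.
have decay (t : R) : 0 <= t -> rel_dist2 (rho t) (gibbs Psi beta)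
    <= rel_dist2 (rho 0) (gibbs Psi beta) *
      expR (- decay_rate adj Psi beta * t).
  apply: (gronwall_decay (f := fun s => rel_dist2 (rho s) (gibbs Psi beta))
    (df := fun s => (\sum_i (rho s ord0 i / gibbs Psi beta ord0 i - 1) *
      fokker_planck2 adj Psi beta (rho s) i) *+ 2)).
  - move=> s s0; apply: rel_dist2_derive => // i; exact: rhod.
  - by apply: rel_dist2_right_cvg => i; exact: cvg_right_of_quotient (rhor i).
  - move=> s /ltW/rhoP sP; have [_ rs0] := sP.
    apply: le_trans (fokker_planck2_dissipation sadj hbeta rs0) _.
    rewrite mulNr lerN2.
    have bm0 := mulr_gt0 hbeta m0.
    apply: le_trans (ler_wpM2l (ltW bm0)
      (rel_dist2_poincare hN sadj hconn sP muP)).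
    (* Dissipation and Poincare combine to twice the decay rate; the surplus copy is then dropped as
       nonnegative. *)
    have -> : beta * min_entry (gibbs Psi beta) * (spectral_gap R adj /
        max_entry (gibbs Psi beta) * rel_dist2 (rho s) (gibbs Psi beta) *+ 2) =
        decay_rate adj Psi beta * rel_dist2 (rho s) (gibbs Psi beta) *+ 2.
      rewrite /decay_rate; move: (min_entry _) (max_entry _)^-1 => m M'.
      by move: (spectral_gap _ _) (rel_dist2 _ _) => g L; ring.
    rewrite mulr2n lerDl mulr_ge0 ?(ltW C0) //.
    by apply: sumr_ge0 => i _; rewrite mulr_ge0 ?sqr_ge0 // ltW.
split=> //; exists (Num.sqrt (rel_dist2 (rho 0) (gibbs Psi beta))).
(* Passing from the squared distance to the distance halves the rate. *)
exists (decay_rate adj Psi beta / 2); split; first by rewrite divr_gt0.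
move=> t /decay decayt; apply: le_trans (euclidean_dist_le muP) _.
apply: le_trans (ler_wsqrtr decayt) _.
rewrite sqrtrM; last by apply: sumr_ge0 => i _;
  rewrite mulr_ge0 ?sqr_ge0 // ltW.
have -> : - decay_rate adj Psi beta * t =
  2%:R * (- (decay_rate adj Psi beta / 2) * t).
  by move: (decay_rate _ _ _) => C; field.
by rewrite expRM_natl sqrtr_sqr ger0_norm ?expR_ge0.
Qed.
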